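(* For $k\ge1$ let $N_k=3^k+1=(10^{k-1}1)_3$. (1) The path set presentation $(\mathcal{G}(N_k),v_0)$ for the path set $X(1,N_k)$ underlying $\mathcal{C}(1,N_k)$ has exactly $2^k$ vertices and is strongly connected. (2) For every integer $k\ge1$, $$\dim_H(\mathcal{C}(1,N_k))=\log_3\left(\frac{1+\sqrt5}{2}\right)\approx0.438018.$$
   Context: $\mathbb{Z}_3$ denotes the $3$-adic integers with the $3$-adic metric ($|3|_3=1/3$), and $\dim_H$ is Hausdorff dimension with respect to it. $\Sigma_3\subset\mathbb{Z}_3$ is the set of all $\sum_{j\ge0}a_j3^j$ with every $a_j\in\{0,1\}$. For an integer $M\ge1$, $\mathcal{C}(1,M)=\{\lambda\in\Sigma_3:M\lambda\in\Sigma_3\}$. The notation $(b_m\cdots b_1b_0)_3$ means $\sum_j b_j3^j$. For $M\equiv1\pmod 3$, $X(1,M)\subset\{0,1\}^{\mathbb{N}}$ is the set of digit sequences $(a_0,a_1,\ldots)$ of elements $\sum a_j3^j$ of $\mathcal{C}(1,M)$, and its presentation $(\mathcal{G}(M),v_0)$ is the following labeled directed graph. From a vertex $v_N$ ($N$ a nonnegative integer) there is an outgoing edge labeled $a\in\{0,1\}$ exactly when $a+N\equiv0$ or $1\pmod3$, and this edge goes to $v_{N'}$ with $N'=\lfloor\frac{N+Ma}{3}\rfloor$. The vertices of $\mathcal{G}(M)$ are exactly those reachable from the marked vertex $v_0$ by such edges (a finite set). A directed graph is strongly connected if for any two vertices $i,j$ there is a directed path from $i$ to $j$. *)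

(* Defs.v *)
From HB Require Import structures.
From mathcomp Require Import all_boot all_order all_algebra.
From mathcomp Require Import all_classical all_reals all_analysis.
From mathcomp Require Import zify.

Set Implicit Arguments.
Unset Strict Implicit.
Unset Printing Implicit Defensive.

Import Order.TTheory GRing.Theory Num.Theory.
Import numFieldNormedType.Exports.

Local Open Scope classical_set_scope.
Local Open Scope ring_scope.

(* Z_3 as the inverse limit of the Z/3^n: [x n] is the residue of [x] modulo
   3^n, taken in {0, ..., 3^n - 1}.  The parameter [R] plays no role in the
   carrier; it only fixes the field in which the 3-adic metric takes its values,
   so that [Z3 R] can be made a [metricType R]. *)
Record Z3 (R : realType) := MkZ3 {
  z3seq :> nat -> nat ;
  z3_coherent : `[< forall n, z3seq n = (z3seq n.+1 %% 3 ^ n)%N >] }.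

Section Z3_ring.
Variable R : realType.

HB.instance Definition _ := [isSub for @z3seq R].
HB.instance Definition _ := [Choice of Z3 R by <:].

Implicit Types x y z : Z3 R.

Lemma z3P x n : x n = (x n.+1 %% 3 ^ n)%N.
Proof. exact: (asboolW (z3_coherent x)). Qed.

Lemma z3_mod x n : (x n %% 3 ^ n)%N = x n.
Proof. by rewrite z3P modn_mod. Qed.

Lemma z3_lt x n : (x n < 3 ^ n)%N.
Proof. by rewrite z3P ltn_mod expn_gt0. Qed.

Lemma z3_eq x y : (forall n, x n = y n) -> x = y.
Proof. by move=> xy; apply/val_inj/funext. Qed.

Lemma modn_exp3S m n : (m %% 3 ^ n.+1 %% 3 ^ n)%N = (m %% 3 ^ n)%N.
Proof. by rewrite modn_dvdm// dvdn_exp2l. Qed.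

Lemma z3_le x m n : (m <= n)%N -> x m = (x n %% 3 ^ m)%N.
Proof.
elim: n => [|n IH]; first by rewrite leqn0 => /eqP ->; rewrite z3_mod.
rewrite leq_eqVlt => /predU1P[->|]; first by rewrite z3_mod.
by rewrite ltnS => mn; rewrite (IH mn) z3P modn_dvdm// dvdn_exp2l.
Qed.

Let mod_coherent (f : nat -> nat) :
  (forall n, f n = f n.+1 %[mod 3 ^ n])%N ->
  `[< forall n, f n %% 3 ^ n = f n.+1 %% 3 ^ n.+1 %% 3 ^ n >]%N.
Proof. by move=> fP; apply/asboolP => n; rewrite modn_exp3S. Qed.

Definition z3_of_nat (m : nat) : Z3 R :=
  @MkZ3 R _ (mod_coherent (f := fun=> m) (fun=> erefl)).

Let add_coherent x y n : (x n + y n = x n.+1 + y n.+1 %[mod 3 ^ n])%N.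
Proof. by rewrite (z3P x) (z3P y) modnDm. Qed.

Definition z3_add x y : Z3 R := @MkZ3 R _ (mod_coherent (add_coherent x y)).

Let mul_coherent x y n : (x n * y n = x n.+1 * y n.+1 %[mod 3 ^ n])%N.
Proof. by rewrite (z3P x) (z3P y) modnMm. Qed.

Definition z3_mul x y : Z3 R := @MkZ3 R _ (mod_coherent (mul_coherent x y)).

Let opp_coherent x n : (3 ^ n - x n = 3 ^ n.+1 - x n.+1 %[mod 3 ^ n])%N.
Proof.
have h0 := z3_lt x n; have h1 := z3_lt x n.+1.
apply/eqP; rewrite -(eqn_modDr (x n.+1)) subnK 1?ltnW//.
by rewrite -modnDmr -z3P subnK 1?ltnW// modnn expnS modnMl.
Qed.

Definition z3_opp x : Z3 R := @MkZ3 R _ (mod_coherent (opp_coherent x)).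

Let z3_addA : associative z3_add.
Proof. by move=> x y z; apply: z3_eq => n /=; rewrite modnDml modnDmr addnA. Qed.

Let z3_addC : commutative z3_add.
Proof. by move=> x y; apply: z3_eq => n /=; rewrite addnC. Qed.

Let z3_add0 : left_id (z3_of_nat 0) z3_add.
Proof. by move=> x; apply: z3_eq => n /=; rewrite modnDml add0n z3_mod. Qed.

Let z3_addN : left_inverse (z3_of_nat 0) z3_opp z3_add.
Proof.
move=> x; apply: z3_eq => n /=.
by rewrite modnDml subnK ?modnn ?mod0n// ltnW// z3_lt.
Qed.

HB.instance Definition _ :=
  GRing.isZmodule.Build (Z3 R) z3_addA z3_addC z3_add0 z3_addN.

Let z3_mulA : associative z3_mul.
Proof.
by move=> x y z; apply: z3_eq => n /=; rewrite modnMml modnMmr mulnA.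
Qed.

Let z3_mulC : commutative z3_mul.
Proof. by move=> x y; apply: z3_eq => n /=; rewrite mulnC. Qed.

Let z3_mul1 : left_id (z3_of_nat 1) z3_mul.
Proof. by move=> x; apply: z3_eq => n /=; rewrite modnMml mul1n z3_mod. Qed.

Let z3_mulDl : left_distributive z3_mul z3_add.
Proof.
by move=> x y z; apply: z3_eq => n /=; rewrite modnMml modnDm mulnDl.
Qed.

Let z3_1neq0 : z3_of_nat 1 != 0.
Proof. by apply/eqP => /(congr1 (fun x : Z3 R => x 1%N)). Qed.

HB.instance Definition _ := GRing.Zmodule_isComNzRing.Build (Z3 R)
  z3_mulA z3_mulC z3_mul1 z3_mulDl z3_1neq0.

Lemma z3_0E n : (0 : Z3 R) n = 0%N.
Proof. exact: mod0n. Qed.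

Lemma z3_addE x y n : (x + y) n = ((x n + y n) %% 3 ^ n)%N.
Proof. by []. Qed.

Lemma z3_mulE x y n : (x * y) n = ((x n * y n) %% 3 ^ n)%N.
Proof. by []. Qed.

Lemma z3_natE (m n : nat) : (m%:R : Z3 R) n = (m %% 3 ^ n)%N.
Proof.
elim: m => [|m IH]; first by rewrite z3_0E mod0n.
by rewrite -natr1 z3_addE IH modnDm addn1.
Qed.

Lemma z3_sub_eq0 x y n : ((x - y) n == 0%N) = (x n == y n).
Proof.
have h : x n = (((x - y)%R n + y n) %% 3 ^ n)%N by rewrite -z3_addE subrK.
apply/eqP/eqP => [e|e]; first by rewrite h e add0n z3_mod.
move/eqP: h; rewrite e -{1}(z3_mod y n) -{1}(add0n (y n)) eqn_modDr mod0n.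
by rewrite z3_mod => /eqP <-.
Qed.

End Z3_ring.

Section Z3_metric.
Variable R : realType.
Implicit Types x y z : Z3 R.

(* The exponent of 3 in [x]; by convention 0 when [x = 0]. *)
Definition val3 x : nat :=
  if pselect (exists n, x n.+1 != 0%N) is left h then ex_minn h else 0%N.

Definition norm3 x : R := if x == 0 then 0 else 3 ^- val3 x.

Lemma norm3_ge0 x : 0 <= norm3 x.
Proof. by rewrite /norm3; case: ifP => // _; rewrite invr_ge0 exprn_ge0. Qed.

Lemma norm3_le x n : (norm3 x <= 3 ^- n) = (x n == 0%N).
Proof.
rewrite /norm3; case: ifPn => [/eqP ->|x0].
  by rewrite z3_0E eqxx invr_ge0 exprn_ge0.
rewrite /val3; case: pselect => [h|h]; last first.
  exfalso; move/eqP: x0; apply; apply: z3_eq => -[|m]; rewrite z3_0E.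
    by have := z3_lt x 0; case: (x 0%N).
  by apply/eqP/negPn/negP => xm; apply: h; exists m.
case: ex_minnP => v xv vmin.
rewrite lef_pV2 ?posrE ?exprn_gt0// ler_eXn2l ?ltr1n//.
apply/idP/eqP => [nv|xn].
  case: n nv => [|n nv]; first by have := z3_lt x 0; case: (x 0%N).
  by apply/eqP/negPn/negP => /vmin; rewrite leqNgt nv.
rewrite leqNgt; apply/negP => vn; move/negP: xv; apply.
by rewrite (z3_le x vn) xn mod0n.
Qed.

Lemma norm3_exp x : x != 0 -> exists n, norm3 x = 3 ^- n.
Proof. by move=> x0; exists (val3 x); rewrite /norm3 (negbTE x0). Qed.

Lemma norm3_eq0 x : norm3 x = 0 -> x = 0.
Proof.
rewrite /norm3; case: eqP => // _ /eqP.
by rewrite invr_eq0 expf_eq0 pnatr_eq0 andbF.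
Qed.

Lemma norm30 : norm3 0 = 0.
Proof. by rewrite /norm3 eqxx. Qed.

Lemma norm3_max x y : norm3 (x + y) <= Num.max (norm3 x) (norm3 y).
Proof.
wlog xy : x y / norm3 x <= norm3 y.
  move=> H; case: (leP (norm3 x) (norm3 y)) => [xy|/ltW yx].
    by have := H _ _ xy; rewrite max_r.
  by have := H _ _ yx; rewrite addrC max_r.
rewrite max_r//; have [y0|y0] := eqVneq y 0.
  have x0 : x = 0.
    by apply/norm3_eq0/eqP; rewrite eq_le norm3_ge0 andbT -norm30 -y0.
  by rewrite x0 y0 addr0.
have [n yn] := norm3_exp y0; move: xy; rewrite yn => xn.
have : norm3 y <= 3 ^- n by rewrite yn.
move: xn; rewrite !norm3_le z3_addE => /eqP -> /eqP ->.
by rewrite addn0 mod0n.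
Qed.

Lemma norm3N x : norm3 (- x) = norm3 x.
Proof.
have le z : norm3 (- z) <= norm3 z.
  have [->|z0] := eqVneq z 0; first by rewrite oppr0.
  have [n zn] := norm3_exp z0; rewrite zn norm3_le.
  have := z3_sub_eq0 0 z n; rewrite sub0r z3_0E => ->.
  by rewrite eq_sym -norm3_le zn.
by apply/eqP; rewrite eq_le le -{1}(opprK x) le.
Qed.

Definition dist3 x y : R := norm3 (x - y).

Let dist3xx x : dist3 x x = 0.
Proof. by rewrite /dist3 subrr norm30. Qed.

Let dist3_pos x y : dist3 x y = 0 -> x = y.
Proof. by move=> /norm3_eq0/eqP; rewrite subr_eq0 => /eqP. Qed.

Let dist3C x y : dist3 x y = dist3 y x.
Proof. by rewrite /dist3 -norm3N opprB. Qed.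

Let dist3_triangle y x z : dist3 x z <= dist3 x y + dist3 y z.
Proof.
rewrite /dist3 -(subrKA y) (le_trans (norm3_max _ _))//.
by rewrite ge_max lerDl lerDr !norm3_ge0.
Qed.

HB.instance Definition _ := isMetric.Build R (Z3 R)
  dist3xx dist3_pos dist3C dist3_triangle.

Lemma mdist3E x y : mdist x y = norm3 (x - y).
Proof. by []. Qed.

Lemma dist3_le x y n : (mdist x y <= 3 ^- n) = (x n == y n).
Proof. by rewrite mdist3E norm3_le z3_sub_eq0. Qed.

End Z3_metric.

Section hausdorff_dimension.
Context {R : realType} {T : metricType R}.
Implicit Types (s d : R) (A E : set T).
Local Open Scope ereal_scope.

Definition diameter A : \bar R :=
  ereal_sup [set (mdist z.1 z.2)%:E | z in A `*` A].

(* Each nonempty set weighs its diameter to the power s (with 0^0 = 1), the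
   empty set weighs 0. *)
Definition hausdorff_weight s A : \bar R :=
  if A == set0 then 0 else diameter A `^ s.

Definition hausdorff_premeasure s d E : \bar R :=
  ereal_inf [set \sum_(0 <= i <oo) hausdorff_weight s (U i) |
    U in [set U : nat -> set T |
      (forall i, diameter (U i) <= d%:E) /\ E `<=` \bigcup_i U i]].

Definition hausdorff_measure s E : \bar R :=
  ereal_sup [set hausdorff_premeasure s d E | d in [set d | (0 < d)%R]].

Definition hausdorff_dim E : \bar R :=
  ereal_inf [set s%:E |
    s in [set s | (0 <= s)%R /\ hausdorff_measure s E = 0]].

End hausdorff_dimension.

Section cantor_intersection.
Variable R : realType.

(* [x] is the sum of the series a_0 + a_1 3 + a_2 3^2 + ... in Z_3. *)
Definition expands_to (a : nat -> bool) (x : Z3 R) : Prop :=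
  (fun n => \sum_(j < n) (a j)%:R * 3 ^+ j : Z3 R) @ \oo --> x.

Definition Sigma3 : set (Z3 R) := [set x | exists a, expands_to a x].

Definition C1 (M : nat) : set (Z3 R) :=
  [set x | Sigma3 x /\ Sigma3 (M%:R * x)].

Definition X1 (M : nat) : set (nat -> bool) :=
  [set a | exists2 x, expands_to a x & C1 M x].

End cantor_intersection.
Arguments Sigma3 : clear implicits.
Arguments C1 : clear implicits.

Section presentation.
Variable M : nat.
Local Open Scope nat_scope.

(* [edge N a N']: there is an edge labeled [a] from v_N to v_N'. *)
Definition edge (N : nat) (a : bool) (N' : nat) : bool :=
  ((a + N) %% 3 \in [:: 0; 1]) && (N' == (N + M * a) %/ 3).

Definition adj : rel nat := [rel N N' | [exists a, edge N a N']].

Definition vertices : set nat :=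
  [set N | exists2 p, path adj 0 p & last 0 p = N].

(* The label sequences of the infinite walks issued from v_0. *)
Definition path_set : set (nat -> bool) :=
  [set a | exists2 v : nat -> nat,
    v 0 = 0 & forall n, edge (v n) (a n) (v n.+1)].

End presentation.

Definition strongly_connected (T : eqType) (V : set T) (e : rel T) : Prop :=
  forall i j, V i -> V j ->
    exists p, [/\ path e i p, (forall x, x \in p -> V x) & last i p = j].

Section presentation_correct.
Variable R : realType.

Definition digit_sum (a : nat -> bool) (n : nat) : nat :=
  (\sum_(j < n) a j * 3 ^ j)%N.

Lemma digit_sumS a n : digit_sum a n.+1 = (digit_sum a n + a n * 3 ^ n)%N.
Proof. by rewrite /digit_sum big_ord_recr. Qed.

Lemma digit_sum_lt a n : (digit_sum a n < 3 ^ n)%N.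
Proof.
elim: n => [|n IH]; first by rewrite /digit_sum big_ord0.
by rewrite digit_sumS expnS; case: (a n); lia.
Qed.

Lemma digit_sum_mod a m n : (m <= n)%N ->
  (digit_sum a n %% 3 ^ m = digit_sum a m)%N.
Proof.
elim: n => [|n IH].
  by rewrite leqn0 => /eqP ->; rewrite modn1 /digit_sum big_ord0.
rewrite leq_eqVlt => /predU1P[->|]; first by rewrite modn_small// digit_sum_lt.
rewrite ltnS => mn; rewrite digit_sumS -(subnK mn) expnD mulnA addnC modnMDl.
by rewrite subnK// IH.
Qed.

Lemma expands_toP a (x : Z3 R) :
  expands_to a x <-> forall n, x n = digit_sum a n.
Proof.
have sumE n : (\sum_(j < n) (a j)%:R * 3 ^+ j : Z3 R) = (digit_sum a n)%:R.
  by rewrite /digit_sum natr_sum; apply: eq_bigr => i _; rewrite natrM natrX.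
rewrite /expands_to; split=> [ax n|ax].
  have e0 : (0 : R) < 3 ^- n by rewrite invr_gt0 exprn_gt0.
  have /ax := nbhsx_ballx x _ e0.
  case=> N _ /(_ (maxn N n)) /=; rewrite leq_maxl => /(_ isT).
  rewrite ballEmdist/= sumE => /ltW; rewrite dist3_le => /eqP ->.
  by rewrite z3_natE digit_sum_mod// leq_maxr.
apply/cvg_ballP => e e0.
have [N Ne] : exists N, (3 : R) ^- N < e.
  have /cvgrPdist_lt/(_ _ e0) : (3^-1 : R) ^+ n @[n --> \oo] --> (0 : R).
    by apply: cvg_expr; rewrite ger0_norm ?invr_ge0// invf_lt1// ltr1n.
  case=> N _ /(_ N (leqnn N)) /=.
  by rewrite sub0r normrN ger0_norm ?exprn_ge0 ?invr_ge0// exprVn; exists N.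
exists N => // n /= Nn; rewrite ballEmdist/= sumE.
by rewrite (le_lt_trans _ Ne)// dist3_le z3_natE digit_sum_mod// ax.
Qed.

Lemma expands_ex a : exists x : Z3 R, expands_to a x.
Proof.
have c : `[< forall n, digit_sum a n = (digit_sum a n.+1 %% 3 ^ n)%N >].
  by apply/asboolP => n; rewrite digit_sum_mod.
by exists (@MkZ3 R _ c); apply/expands_toP.
Qed.

(* The graph does present X(1, M). *)
Lemma path_setE M : (M %% 3 = 1)%N -> path_set M = X1 R M.
Proof.
move=> M1; apply/seteqP; split=> a.
  case=> v v0 va; have [x ax] := expands_ex a; exists x => //.
  split; first by exists a.
  pose d n := ((a n + v n) %% 3)%N == 1%N.
  exists d; apply/expands_toP => n.
  have xE m : x m = digit_sum a m by apply/expands_toP: m.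
  have key : (M * digit_sum a n = digit_sum d n + v n * 3 ^ n)%N.
    elim: n => [|n IH]; first by rewrite v0 /digit_sum !big_ord0 muln0.
    have /andP[+ /eqP vS] := va n; rewrite !inE => dn.
    rewrite !digit_sumS mulnDr IH vS expnS.
    have : (v n + M * a n = 3 * ((v n + M * a n) %/ 3) + d n)%N.
      rewrite {1}(divn_eq (v n + M * a n) 3) mulnC; congr addn.
      rewrite -modnDmr -modnMml M1 mul1n modnDmr addnC /d.
      by case/orP: dn => /eqP ->.
    by move: (_ %/ 3)%N (3 ^ n)%N => q t; nia.
  rewrite z3_mulE z3_natE xE modnMml key addnC modnMDl.
  by rewrite modn_small// digit_sum_lt.
case=> x ax [_ [d dP]].
have xE m : x m = digit_sum a m by apply/expands_toP: m.
have dE m : ((M%:R * x) m = digit_sum d m) by apply/expands_toP: m.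
pose v n := (M * digit_sum a n %/ 3 ^ n)%N.
have key n : (M * digit_sum a n = v n * 3 ^ n + digit_sum d n)%N.
  rewrite {1}(divn_eq (M * digit_sum a n) (3 ^ n)); congr addn.
  by rewrite -dE z3_mulE z3_natE xE modnMml.
exists v => [|n]; first by rewrite /v /digit_sum big_ord0 muln0.
have step : (v n + M * a n = v n.+1 * 3 + d n)%N.
  have t0 : (0 < 3 ^ n)%N by rewrite expn_gt0.
  have := key n.+1; rewrite !digit_sumS mulnDr key expnS.
  by move: (3 ^ n)%N t0 => t t0; nia.
have dn : (d n %% 3 = d n)%N by case: (d n).
have d3 : (d n %/ 3 = 0)%N by case: (d n).
rewrite /edge step divnMDl// d3 addn0 eqxx andbT.
have -> : ((a n + v n) %% 3 = d n)%N.
  have Ma : (M * a n = a n %[mod 3])%N by rewrite -modnMml M1 mul1n.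
  by rewrite addnC -modnDmr -Ma modnDmr step modnMDl dn.
by case: (d n).
Qed.

End presentation_correct.

(* Main.v *)
(* A vertex reachable from 0 in the graph of 3^k + 1 has k ternary digits, all 0
   or 1, and an edge shifts this window by one place; a new digit 1 is allowed
   exactly when the digit that drops out is 0.  Hence every window is a vertex,
   and every vertex leads to 0.  Likewise multiplication by 3^k + 1 adds to the
   digits (a_n) their translate by k, so C(1, 3^k + 1) consists of the digit
   sequences with a_n a_(n+k) = 0: k interleaved golden mean shifts.
   With g the golden ratio, put mass g^-(n + number of 1s among the last k
   digits) on an admissible word of length n.  This mass is additive and lies between
   g^-(n+k) and g^-n.  The left bound says that there are at most g^(n+k)
   admissible words, which gives the upper bound on the dimension, and the right
   one gives the lower bound through the mass distribution principle. *)
Require Import Defs.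
From mathcomp Require Import all_boot all_order all_algebra.
From mathcomp Require Import all_classical all_reals all_analysis.
From mathcomp Require Import zify ring lra.

Set Implicit Arguments.
Unset Strict Implicit.
Unset Printing Implicit Defensive.

Import Order.TTheory GRing.Theory Num.Theory.
Import numFieldNormedType.Exports.

Local Open Scope classical_set_scope.
Local Open Scope ring_scope.

(** * Words of digits 0 and 1 read in base 3 *)

(** The leading digit comes first, so that an edge of the graph conses the new digit and drops the
    last one. *)
Fixpoint word_val (w : seq bool) : nat :=
  if w is b :: w' then (b * 3 ^ size w' + word_val w')%N else 0%N.

Lemma word_val_lt w : (word_val w < 3 ^ size w)%N.
Proof. by elim: w => //= b w IH; rewrite expnS; case: b; lia. Qed.

Lemma word_val_rcons w c : word_val (rcons w c) = (c + 3 * word_val w)%N.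
Proof.
elim: w => [|b w IH] /=; first by rewrite muln1 muln0.
by rewrite IH size_rcons expnS; lia.
Qed.

Lemma word_val_nseq0 n : word_val (nseq n false) = 0%N.
Proof. by elim: n => //= n ->. Qed.

Lemma word_val_inj w1 w2 :
  size w1 = size w2 -> word_val w1 = word_val w2 -> w1 = w2.
Proof.
elim: w1 w2 => [|b1 w1 IH] [|b2 w2] //= [] sz.
have := word_val_lt w1; have := word_val_lt w2; rewrite sz => lt2 lt1.
by case: b1; case: b2 => e; try lia; congr cons; apply: IH => //; lia.
Qed.

(** * The graph: number of vertices and strong connectivity *)

Section graph.
Variable k : nat.
Let M := (3 ^ k.+1 + 1)%N.

(* A vertex is a window of [k.+1] consecutive digits, and an edge shifts the
   window, dropping the oldest digit [c] and adding [a] on top. *)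
Lemma edge_word w c a N' : size w = k ->
  edge M (word_val (rcons w c)) a N' =
  ~~ (a && c) && (N' == word_val (a :: w)).
Proof.
move=> sw; rewrite /edge word_val_rcons /= sw /M expnS; congr andb.
  rewrite addnA [(3 * _)%N]mulnC addnC modnMDl.
  by case: a; case: c.
(* The remainder [a + c] is at most 2, so nothing is carried and the quotient is the shifted
   window. *)
have -> : (c + 3 * word_val w + (3 * 3 ^ k + 1) * a =
           (a * 3 ^ k + word_val w) * 3 + (a + c))%N by nia.
by rewrite divnMDl//; case: a; case: c; rewrite ?addn0.
Qed.

Lemma adj_word w c a : size w = k -> ~~ (a && c) ->
  adj M (word_val (rcons w c)) (word_val (a :: w)).
Proof. by move=> sw ac; apply/existsP; exists a; rewrite edge_word// ac eqxx. Qed.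

Lemma adj_from_word w N' : size w = k.+1 -> adj M (word_val w) N' ->
  exists2 w', size w' = k.+1 & N' = word_val w'.
Proof.
case/lastP: w => // w c; rewrite size_rcons => -[sw] /existsP[a].
rewrite edge_word// => /andP[_ /eqP ->]; exists (a :: w) => //=.
by rewrite sw.
Qed.

Lemma path_from_word w p : size w = k.+1 -> path (adj M) (word_val w) p ->
  exists2 w', size w' = k.+1 & last (word_val w) p = word_val w'.
Proof.
elim: p w => [|x p IH] w sw /=; first by exists w.
by move=> /andP[/(adj_from_word sw)[w' sw' ->]]; exact: IH.
Qed.

(** The digits of [u] enter from the last to the first. Only initial zeros drop out meanwhile, so no
    edge is blocked. *)
Lemma path_zeros_to_word u n : (size u + n = k.+1)%N ->
  exists2 p, path (adj M) 0 p & last 0%N p = word_val (u ++ nseq n false).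
Proof.
elim: u n => [|b u IH] n /=; first by exists [::]; rewrite //= word_val_nseq0.
move=> un; have [|p pp lp] := IH n.+1; first by lia.
exists (rcons p (word_val (b :: u ++ nseq n false))); last by rewrite last_rcons.
have us : u ++ nseq n.+1 false = rcons (u ++ nseq n false) false.
  by rewrite -addn1 nseqD catA cats1.
rewrite rcons_path pp lp us; apply: adj_word; last by rewrite andbF.
by rewrite size_cat size_nseq; lia.
Qed.

(** The digit 0 may always enter, so zeros flush out any window. *)
Lemma path_word_to_zeros w n : size w = k.+1 -> (n <= k.+1)%N ->
  exists2 p, path (adj M) (word_val w) p &
    last (word_val w) p = word_val (nseq n false ++ take (k.+1 - n) w).
Proof.
move=> sw; elim: n => [|n IH] nk.
  by exists [::]; rewrite //= subn0 take_oversize// sw.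
have [p pp lp] := IH (ltnW nk).
set w' := nseq n false ++ take (k.+1 - n.+1) w.
exists (rcons p (word_val (false :: w'))); last by rewrite last_rcons.
rewrite rcons_path pp lp.
have -> : (k.+1 - n = (k.+1 - n.+1).+1)%N by lia.
rewrite (take_nth false) -?rcons_cat; last by rewrite sw; lia.
by apply: adj_word; rewrite // size_cat size_nseq size_take sw; case: ifP; lia.
Qed.

Lemma verticesE : vertices M = word_val @` [set w | size w = k.+1].
Proof.
apply/seteqP; split=> [_ [p + <-]|_ [w sw <-]].
  rewrite -(word_val_nseq0 k.+1) => /path_from_word[|w' sw' ->].
    by rewrite size_nseq.
  by exists w'.
have [|p pp lp] := @path_zeros_to_word w 0; first by rewrite addn0.
by exists p; rewrite // lp cats0.
Qed.

Lemma card_vertices : (vertices M #= `I_(2 ^ k.+1))%card.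
Proof.
have -> : vertices M = range (fun t : k.+1.-tuple bool => word_val t).
  rewrite verticesE; apply/seteqP; split=> [_ [w /eqP sw <-]|_ [t _ <-]].
    by exists (Tuple sw).
  by exists t => //=; rewrite size_tuple.
rewrite (card_eql (inj_card_eq _)); last first.
  by move=> t1 t2 _ _ /word_val_inj e; apply/val_inj/e; rewrite !size_tuple.
have -> : (2 ^ k.+1 = #|{: k.+1.-tuple bool}|)%N by rewrite card_tuple card_bool.
rewrite (card_eqr card_II).
have -> : [set: k.+1.-tuple bool] =
    range (fun i : 'I_#|{: k.+1.-tuple bool}| => enum_val i).
  by apply/seteqP; split=> // t _; exists (enum_rank t); rewrite ?enum_rankK.
by apply: inj_card_eq => i j _ _; exact: enum_val_inj.
Qed.

Lemma vertices_path i p : vertices M i -> path (adj M) i p ->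
  forall x, x \in p -> vertices M x.
Proof.
move=> [q pq <-] pp x xp; have : x \in last 0%N q :: p by rewrite inE xp orbT.
move=> /splitPl xp'; case: xp' pp => p1 p2 <-; rewrite cat_path => /andP[pp1 _].
by exists (q ++ p1); rewrite ?last_cat// cat_path pq.
Qed.

Lemma vertices_strongly_connected :
  strongly_connected (vertices M) (adj M).
Proof.
move=> i j Vi [q pq lq].
have [w sw wi] : (word_val @` [set w | size w = k.+1]) i by rewrite -verticesE.
have [p] := path_word_to_zeros sw (leqnn _).
rewrite subnn take0 cats0 word_val_nseq0 wi => pp lp.
have ppq : path (adj M) i (p ++ q) by rewrite cat_path pp lp.
exists (p ++ q); split => //; last by rewrite last_cat lp.
exact: vertices_path Vi ppq.
Qed.

End graph.

(** * Admissible words and their mass *)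

Section admissible_words.
Variable k : nat.

(* The list of the last digits comes first, so that [nth false w k] is the
   digit that stands [k.+1] places below the digit to be added. *)
Fixpoint admissible (w : seq bool) : bool :=
  if w is b :: w' then ~~ (b && nth false w' k) && admissible w' else true.

Fixpoint prefix_word (a : nat -> bool) (n : nat) : seq bool :=
  if n is m.+1 then a m :: prefix_word a m else [::].

Definition gap_free (a : nat -> bool) := forall n, ~~ (a n && a (n + k.+1)%N).

Lemma size_prefix_word a n : size (prefix_word a n) = n.
Proof. by elim: n => //= n ->. Qed.

Lemma word_val_prefix a n : word_val (prefix_word a n) = digit_sum a n.
Proof.
elim: n => [|n IH]; first by rewrite /digit_sum big_ord0.
by rewrite /= size_prefix_word IH digit_sumS addnC.
Qed.

Lemma nth_prefix_word a n i : nth false (prefix_word a (n + i.+1)) i = a n.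
Proof.
elim: i => [|i IH]; first by rewrite addn1.
by rewrite addnS /= IH.
Qed.

Lemma gap_freeP a : gap_free a <-> forall n, admissible (prefix_word a n).
Proof.
split=> [af|aa n].
  elim=> //= n ->; rewrite andbT.
  (* In a prefix of length at most [k] no digit stands [k.+1] places below the new one, and the
     default [false] of [nth] makes the constraint void. *)
  case: (leqP k.+1 n) => kn.
    by rewrite -(subnK kn) nth_prefix_word andbC af.
  by rewrite nth_default ?andbF// size_prefix_word.
have := aa (n + k.+1).+1; rewrite /= nth_prefix_word andbC => /andP[_].
by rewrite andbC.
Qed.

Fixpoint words (n : nat) : seq (seq bool) :=
  if n is m.+1 then
    [seq false :: w | w <- words m] ++
    [seq true :: w | w <- words m & ~~ nth false w k]
  else [:: [::]].

Lemma mem_words w : (w \in words (size w)) = admissible w.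
Proof.
elim: w => //= b w IH; rewrite mem_cat.
have cons_inj c : injective (cons c : seq bool -> seq bool) by move=> u v [].
case: b; last first.
  rewrite mem_map// IH orbC; case: mapP => // -[u _] //.
rewrite orbC mem_map// mem_filter IH; case: mapP => [[u _]|] //.
by rewrite orbF.
Qed.

Lemma size_words n w : w \in words n -> size w = n.
Proof.
elim: n w => [|n IH] w /=; first by rewrite inE => /eqP ->.
rewrite mem_cat => /orP[] /mapP[u]; rewrite ?mem_filter.
  by move=> /IH <- ->.
by move=> /andP[_ /IH <-] ->.
Qed.

Section mass.
Variables (R : realType) (g : R).
Hypotheses (g_gt1 : 1 < g) (g_sqr : g ^+ 2 = g + 1).

(* The Markov measure of the cylinder [w]: in each of the [k.+1] interleaved
   golden mean shifts, a block of length m has mass g^-m if it ends in 0 and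
   g^-(m+1) if it ends in 1. *)
Definition mass (w : seq bool) : R := g ^- (size w + count id (take k.+1 w)).

Let g_gt0 : 0 < g. Proof. exact: lt_trans g_gt1. Qed.

Lemma mass_le w : mass w <= g ^- size w.
Proof.
by rewrite lef_pV2 ?posrE ?exprn_gt0// ler_eXn2l// leq_addr.
Qed.

Lemma mass_ge w : g ^- (size w + k.+1) <= mass w.
Proof.
rewrite lef_pV2 ?posrE ?exprn_gt0// ler_eXn2l// leq_add2l.
by rewrite (leq_trans (count_size _ _))// size_take; case: ltnP.
Qed.

(** If the digit leaving the window is 0, this is [g ^- m = g ^- m.+1 + g ^- m.+2], a form of
    [g_sqr]. If it is 1, only 0 may follow: the length grows by one, the count of 1s drops by one,
    and the mass is unchanged. *)
Lemma mass_cons w :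
  mass w = mass (false :: w) + (if nth false w k then 0 else mass (true :: w)).
Proof.
have gneq0 : g != 0 by rewrite gt_eqF.
have split n : g ^- n = g ^- n.+1 + g ^- n.+2.
  rewrite -[n.+2]addn2 -[n.+1]addn1 !exprD expr1 g_sqr.
  have gn0 : g ^+ n != 0 by rewrite expf_neq0.
  have g1 : g + 1 != 0 by rewrite -g_sqr expf_neq0.
  move: (g ^+ n) gn0 => t t0; field: g_sqr.
  by rewrite gneq0 g1 t0.
have ctake : count id (take k.+1 w) = (count id (take k w) + nth false w k)%N.
  case: (ltnP k (size w)) => kw.
    by rewrite (take_nth false kw) -cats1 count_cat /= addn0.
  by rewrite nth_default// !take_oversize ?addn0// ltnW.
rewrite /mass ctake /=; case: (nth false w k) => /=.
  by rewrite addr0 add0n addn1 addnS addSn.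
by rewrite addn0 add0n add1n addSn addnS; exact: split.
Qed.

Lemma sum_mass_words n : \sum_(w <- words n) mass w = 1.
Proof.
elim: n => [|n IH]; first by rewrite big_seq1 /mass /= invr1.
rewrite /= big_cat !big_map big_filter -[RHS]IH.
transitivity (\sum_(w <- words n) (mass (false :: w) +
    (if nth false w k then 0 else mass (true :: w)))).
  rewrite big_split /=; congr (_ + _); rewrite big_mkcond.
  by apply: eq_bigr => w _; case: (nth _ _ _).
by apply: eq_bigr => w _; rewrite [RHS]mass_cons.
Qed.

Lemma size_words_le n : (size (words n))%:R <= g ^+ (n + k.+1).
Proof.
have h : (size (words n))%:R * g ^- (n + k.+1) <= 1.
  rewrite -[in leRHS](sum_mass_words n) -sum1_size natr_sum big_distrl /=.
  rewrite !big_seq; apply: ler_sum => w /size_words <-.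
  by rewrite mul1r mass_ge.
by rewrite -[leRHS]mul1r -ler_pdivrMr// exprn_gt0.
Qed.

End mass.
End admissible_words.

(** * The digits of the elements of [C1] *)

Section C1.
Variables (R : realType) (k : nat).
Let M := (3 ^ k.+1 + 1)%N.

(** With digits at most 1, two such sums add up without reaching the modulus [3 ^ n]. *)
Lemma digit_sum_half a n : (2 * digit_sum a n < 3 ^ n)%N.
Proof.
elim: n => [|n IH]; first by rewrite /digit_sum big_ord0.
by rewrite digit_sumS expnS; case: (a n); lia.
Qed.

(** The congruences are equalities by [digit_sum_half]; subtracting consecutive ones leaves
    [a n + b n = d n], which is at most 1. *)
Lemma digit_sum_disjoint a b d :
  (forall n, digit_sum a n + digit_sum b n = digit_sum d n %[mod 3 ^ n])%N ->
  forall n, ~~ (a n && b n).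
Proof.
move=> abd n.
have e m : (digit_sum a m + digit_sum b m = digit_sum d m)%N.
  have := abd m; rewrite !modn_small ?digit_sum_lt//.
  by have := digit_sum_half a m; have := digit_sum_half b m; lia.
have := e n.+1; rewrite !digit_sumS; have := e n.
have := expn_gt0 3 n; case: (a n); case: (b n); case: (d n) => //=; lia.
Qed.

Definition shift_digits (a : nat -> bool) (j : nat) : bool :=
  (k.+1 <= j)%N && a (j - k.+1)%N.

Lemma digit_sum_shift a n :
  (3 ^ k.+1 * digit_sum a n = digit_sum (shift_digits a) n %[mod 3 ^ n])%N.
Proof.
have -> : (3 ^ k.+1 * digit_sum a n = digit_sum (shift_digits a) (n + k.+1))%N.
  elim: n => [|n IH].
    rewrite add0n {1}/digit_sum big_ord0 muln0 /digit_sum big1// => j _.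
    by rewrite /shift_digits leqNgt ltn_ord.
  rewrite addSn !digit_sumS mulnDr IH /shift_digits leq_addl addnK /=.
  by rewrite expnD; nia.
by rewrite digit_sum_mod ?leq_addr// modn_small// digit_sum_lt.
Qed.

Lemma C1E (x : Z3 R) :
  C1 R M x <-> exists2 a, expands_to a x & gap_free k a.
Proof.
have mulE a : expands_to a x -> forall n, (M%:R * x) n =
    ((digit_sum a n + digit_sum (shift_digits a) n) %% 3 ^ n)%N.
  move=> /expands_toP ax n; rewrite z3_mulE z3_natE ax modnMml.
  by rewrite /M mulnDl mul1n addnC -modnDmr digit_sum_shift modnDmr.
split=> [[[a ax] [d /expands_toP dP]]|[a ax af]].
  exists a => // n.
  have /(_ (n + k.+1)%N) : forall j, ~~ (a j && shift_digits a j).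
    apply: (@digit_sum_disjoint _ _ d) => m.
    by rewrite -mulE// dP modn_small// digit_sum_lt.
  by rewrite /shift_digits leq_addl addnK andbC.
split; first by exists a.
(* No two 1s meet, so the addition has no carry and the disjunction gives the digits of the sum. *)
exists (fun j => a j || shift_digits a j); apply/expands_toP => n.
have dj j : ~~ (a j && shift_digits a j).
  rewrite /shift_digits; case: (leqP k.+1 j) => kj /=; last by rewrite andbF.
  by have := af (j - k.+1)%N; rewrite subnK// andbC.
rewrite (mulE a ax).
have -> : digit_sum (fun j => a j || shift_digits a j) n =
    (digit_sum a n + digit_sum (shift_digits a) n)%N.
  rewrite /digit_sum -big_split; apply: eq_bigr => j _.
  by have := dj j; case: (a j); case: (shift_digits a j) => //= _; lia.
rewrite modn_small//.
by have := digit_sum_half a n; have := digit_sum_half (shift_digits a) n; lia.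
Qed.

End C1.

(** * Numerical estimates for the golden ratio and the dimension *)

Section golden.
Variable R : realType.

Definition golden : R := (1 + Num.sqrt 5) / 2.

Lemma golden_bounds :
  1618 / 10 ^+ 3 + 33 / 10 ^+ 6 <= golden <= 1618 / 10 ^+ 3 + 34 / 10 ^+ 6.
Proof.
have s0 : 0 <= Num.sqrt 5 :> R by exact: sqrtr_ge0.
have s2 : Num.sqrt 5 ^+ 2 = 5 :> R by rewrite sqr_sqrtr.
have le_sqrt c : 0 <= c -> c ^+ 2 <= 5 -> c <= Num.sqrt 5 :> R.
  by move=> c0 c5; rewrite -(@ler_pXn2r _ 2)// s2.
have sqrt_le c : 0 <= c -> 5 <= c ^+ 2 -> Num.sqrt 5 <= c :> R.
  by move=> c0 c5; rewrite -(@ler_pXn2r _ 2)// s2.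
have l : 2236 / 10 ^+ 3 + 66 / 10 ^+ 6 <= Num.sqrt 5 :> R.
  by apply: le_sqrt; lra.
have u : Num.sqrt 5 <= 2236 / 10 ^+ 3 + 68 / 10 ^+ 6 :> R.
  by apply: sqrt_le; lra.
by rewrite /golden; apply/andP; split; lra.
Qed.

Lemma golden_gt1 : 1 < golden.
Proof. by have := golden_bounds; lra. Qed.

Lemma golden_sqr : golden ^+ 2 = golden + 1.
Proof.
have s2 : Num.sqrt 5 ^+ 2 = 5 :> R by rewrite sqr_sqrtr.
by rewrite /golden; field: s2.
Qed.

(** In [e8], the choice [x = -1/8] gives [e <= (8/7)^8 < 3], and [x = 3/20] gives
    [3 < (23/20)^8 <= e^(6/5)]. *)
Lemma ln3_bounds : 1 <= ln (3 : R) <= 6 / 5.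
Proof.
have e8 (x : R) : (1 + x) ^+ 8 <= expR (x *+ 8) \/ 1 + x < 0.
  case: (leP 0 (1 + x)) => x0; [left|by right].
  by rewrite -mulr_natr expRM_natr lerXn2r// ?nnegrE ?expR_ge0// expR_ge1Dx.
apply/andP; split.
  rewrite -ler_expR lnK ?posrE//.
  have [h|] := e8 (- 8^-1); last by lra.
  have e1 : (- 8^-1) *+ 8 = - (1 : R) by lra.
  rewrite e1 expRN in h.
  have e0 : 0 < expR (1 : R) by exact: expR_gt0.
  rewrite leNgt; apply/negP => e3.
  have : (expR (1 : R))^-1 < 3^-1 by rewrite ltf_pV2 ?posrE.
  lra.
rewrite -ler_expR lnK ?posrE//.
have [h|] := e8 (3 / 20); last by lra.
have e1 : (3 / 20) *+ 8 = 6 / 5 :> R by lra.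
by rewrite e1 in h; lra.
Qed.

(** Writing [121 = 16 * 7 + 9] and [53 = 7 * 7 + 4] leaves factors close to 1. Powers of [golden]
    are linear in [golden] with Fibonacci coefficients, so six decimals of [golden] suffice. *)
Lemma golden_pow121 :
  1 + 15 / 10 ^+ 5 <= golden ^+ 121 / 3 ^+ 53 <= 1 + 23 / 10 ^+ 5.
Proof.
have split121 (x y : R) :
    x ^+ 121 / y ^+ 53 = (x ^+ 16 / y ^+ 7) ^+ 7 * (x ^+ 9 / y ^+ 4).
  by rewrite expr_div_n -!exprM mulrACA -exprD -invfM -exprD.
have mono (a b c d : R) : 0 <= a -> 0 <= b -> a <= c -> b <= d ->
    a ^+ 7 * b <= c ^+ 7 * d.
  move=> a0 b0 ac bd; apply: ler_pM => //; first exact: exprn_ge0.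
  by rewrite lerXn2r// nnegrE (le_trans a0).
(* [a] and [c] bracket [golden ^+ 16 / 3 ^+ 7]; [b] and [d] bracket [golden ^+ 9 / 3 ^+ 4]. *)
pose a : R := 1 + 9144 / 10 ^+ 6; pose b : R := 938 / 10 ^+ 3 + 432 / 10 ^+ 6.
pose c : R := 1 + 9146 / 10 ^+ 6; pose d : R := 938 / 10 ^+ 3 + 435 / 10 ^+ 6.
have a0 : 0 <= a by rewrite /a; lra.
have b0 : 0 <= b by rewrite /b; lra.
have low : 1 + 15 / 10 ^+ 5 <= a ^+ 7 * b by rewrite /a /b; clear; lra.
have up : c ^+ 7 * d <= 1 + 23 / 10 ^+ 5 by rewrite /c /d; clear; lra.
have g2 := golden_sqr; have gb := golden_bounds.
have g4 : golden ^+ 4 = 3 * golden + 2.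
  by rewrite -[4%N]/(2 * 2)%N exprM g2; ring: g2.
have g8 : golden ^+ 8 = 21 * golden + 13.
  by rewrite -[8%N]/(4 * 2)%N exprM g4; ring: g2.
have g9 : golden ^+ 9 = 34 * golden + 21 by rewrite exprS g8; ring: g2.
have g16 : golden ^+ 16 = 987 * golden + 610.
  by rewrite -[16%N]/(8 * 2)%N exprM g8; ring: g2.
rewrite split121 g9 g16.
have : a <= (987 * golden + 610) / 3 ^+ 7 <= c.
  by rewrite /a /c; clear -gb; lra.
have : b <= (34 * golden + 21) / 3 ^+ 4 <= d.
  by rewrite /b /d; clear -gb; lra.
move: (_ / 3 ^+ 7) (_ / 3 ^+ 4) => A B /andP[B1 B2] /andP[A1 A2].
apply/andP; split; first exact: le_trans low (mono _ _ _ _ a0 b0 A1 B1).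
exact: le_trans (mono _ _ _ _ (le_trans a0 A1) (le_trans b0 B1) A2 B2) up.
Qed.

(* 53 / 121 is the convergent of the dimension that precedes the large partial
   quotient 49: it pins the dimension down as soon as [golden ^+ 121 / 3 ^+ 53]
   and [ln 3] are roughly known. *)
Lemma golden_dim_approx :
  `|ln golden / ln 3 - (438 / 10 ^+ 3 + 18 / 10 ^+ 6)| <= 5 / 10 ^+ 7.
Proof.
have /andP[l1 l2] := ln3_bounds.
have g0 : 0 < golden by have := golden_gt1; lra.
have lnr (x y : R) : 0 < x -> 0 < y ->
    ln (x ^+ 121 / y ^+ 53) = 121 * ln x - 53 * ln y.
  move=> x0 y0; rewrite ln_div ?posrE ?exprn_gt0// !lnXn//.
  by rewrite -[in LHS]mulr_natl -[_ *+ 53]mulr_natl.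
have ln_bounds (r : R) : 0 < r -> 1 - r^-1 <= ln r <= r - 1.
  move=> r0; apply/andP; split; last first.
    by rewrite -{1}(subrK 1 r) addrC le_ln1Dx//; lra.
  have := @le_ln1Dx _ (r^-1 - 1); rewrite addrCA subrr addr0 lnV ?posrE//.
  by have : 0 < r^-1 by [rewrite invr_gt0]; lra.
have := golden_pow121; have := lnr _ 3 g0 (ltr0n _ 3).
move: (golden ^+ 121 / 3 ^+ 53) => r lnE /andP[r1 r2].
have r0 : 0 < r by lra.
(* The dimension is 53/121 plus [ln r / (121 * ln 3)], a correction of order [10 ^- 6]. *)
have := ln_bounds r r0; rewrite lnE => /andP[u1 u2].
have rV : r^-1 <= 1 - 145 / 10 ^+ 6.
  by rewrite -[leLHS]div1r ler_pdivrMr//; lra.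
have y0 : 0 < ln (3 : R) by lra.
rewrite ler_distl; apply/andP; split.
  by rewrite ler_pdivlMr//; lra.
by rewrite ler_pdivrMr//; lra.
Qed.

End golden.

(** * Sets of Hausdorff measure zero and their covers *)

Section hausdorff_zero.
Variables (R : realType) (T : metricType R).
Local Open Scope ereal_scope.

Lemma hausdorff_weight_ge0 s (A : set T) : 0 <= hausdorff_weight s A.
Proof. by rewrite /hausdorff_weight; case: ifP => // _; exact: poweR_ge0. Qed.

Lemma le_diameter (A : set T) x y : A x -> A y -> (mdist x y)%:E <= diameter A.
Proof. by move=> Ax Ay; apply: ereal_sup_ubound; exists (x, y). Qed.

Lemma diameter_ge0 (A : set T) x : A x -> 0 <= diameter A.
Proof. by move=> Ax; rewrite -[0](congr1 EFin (mdistxx x)) le_diameter. Qed.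

Lemma hausdorff_premeasure_ge0 s d (E : set T) : 0 <= hausdorff_premeasure s d E.
Proof.
apply: le_ereal_inf_tmp => _ [U _ <-].
by apply: nneseries_ge0 => i _ _; exact: hausdorff_weight_ge0.
Qed.

Lemma hausdorff_measure_eq0 s (E : set T) :
  (forall e : R, (0 < e)%R -> exists U : nat -> set T,
    [/\ forall i, diameter (U i) <= e%:E, E `<=` \bigcup_i U i &
        \sum_(0 <= i <oo) hausdorff_weight s (U i) <= e%:E]) ->
  hausdorff_measure s E = 0.
Proof.
move=> cov; apply/eqP; rewrite eq_le; apply/andP; split; last first.
  apply: le_trans (hausdorff_premeasure_ge0 s 1 E) _.
  by apply: ereal_sup_ubound; exists 1%R => //=; rewrite ltr01.
apply: ge_ereal_sup => _ [d /= d0 <-]; apply/lee_addgt0Pr => e e0.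
have [|U [dU EU sU]] := cov (Num.min d e); first by rewrite lt_min d0.
rewrite add0e; apply: (@le_trans _ _ (\sum_(0 <= i <oo) hausdorff_weight s (U i))).
  apply: ereal_inf_lbound; exists U => //; split=> // i.
  by apply: le_trans (dU i) _; rewrite lee_fin ge_min lexx.
by apply: le_trans sU _; rewrite lee_fin ge_min lexx orbT.
Qed.

(** The lower bound treats covers of any mesh, so the single scale 1 is enough. *)
Lemma hausdorff_measure0_cover s (E : set T) (e : R) :
  hausdorff_measure s E = 0 -> (0 < e)%R ->
  exists2 U : nat -> set T, E `<=` \bigcup_i U i &
    \sum_(0 <= i <oo) hausdorff_weight s (U i) < e%:E.
Proof.
move=> E0 e0; have : hausdorff_premeasure s 1 E < e%:E.
  apply: (@le_lt_trans _ _ 0); last by rewrite lte_fin.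
  by rewrite -E0; apply: ereal_sup_ubound; exists 1%R => //=; rewrite ltr01.
by move=> /ereal_inf_lt[_ [U [_ EU] <-]]; exists U.
Qed.

End hausdorff_zero.

Lemma exists_expr_small (R : realType) (c q e : R) :
  `|q| < 1 -> 0 < e -> exists N, forall n, (N <= n)%N -> c * q ^+ n < e.
Proof.
move=> q1 e0; have /cvgrPdist_lt/(_ _ e0)[N _ NP] := cvg_geometric c q1.
exists N => n /NP /=; rewrite sub0r normrN.
by apply: le_lt_trans; exact: ler_norm.
Qed.

(** * Hausdorff measure of [C1] on both sides of the critical exponent *)

Section dimension.
Variables (R : realType) (k : nat) (g : R).
Hypotheses (g_gt1 : 1 < g) (g_sqr : g ^+ 2 = g + 1).
Let M := (3 ^ k.+1 + 1)%N.
Let E := C1 R M.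

Let g_gt0 : 0 < g. Proof. exact: lt_trans g_gt1. Qed.

Lemma diameter_cylinder_le (A : set (Z3 R)) n :
  (forall x y, A x -> A y -> x n = y n) -> (diameter A <= (3 ^- n)%:E)%E.
Proof.
move=> An; apply: ge_ereal_sup => _ [[x y] [/= Ax Ay] <-].
by rewrite lee_fin dist3_le (An x y).
Qed.

Lemma powR_exprVn (x s : R) n : 0 <= x -> (x ^- n) `^ s = (x `^ s) ^- n.
Proof.
move=> x0; rewrite -(powR_invn n x0) -(powR_invn n (powR_ge0 x s)).
by rewrite -[LHS]powRrM -[RHS]powRrM mulrC.
Qed.

Lemma C1_word x n : E x -> exists2 w, w \in words k n & x n = word_val w.
Proof.
move=> /C1E[a /expands_toP ax /gap_freeP af]; exists (prefix_word a n).
  by rewrite -{2}(size_prefix_word a n) mem_words.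
by rewrite word_val_prefix.
Qed.

(** * Upper bound: covers by cylinders of one level *)

Section upper.
Variable s : R.
Hypotheses (s_ge0 : 0 <= s) (g_lt : g < 3 `^ s).

(** At most [g ^+ (n + k.+1)] cylinders of level [n] are needed, so their total weight is at most
    [g ^+ k.+1] times the [n]-th power of a ratio below 1. *)
Lemma C1_hausdorff_measure0 : hausdorff_measure s E = 0%E.
Proof.
apply: hausdorff_measure_eq0 => e e0.
have q1 : `|g / 3 `^ s| < 1.
  rewrite ger0_norm ?divr_ge0 ?powR_ge0// ?ltW//.
  by rewrite ltr_pdivrMr ?mul1r// (lt_trans g_gt0).
have v1 : `|3^-1 : R| < 1 by rewrite ger0_norm ?invr_ge0// invf_lt1// ltr1n.
have [N1 N1P] := exists_expr_small (g ^+ k.+1) q1 e0.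
have [N2 N2P] := exists_expr_small 1 v1 e0.
(* [N1] makes the total weight small, [N2] the mesh. *)
pose n := maxn N1 N2; pose W := words k n.
pose U i : set (Z3 R) :=
  if (i < size W)%N then [set x | x n = word_val (nth [::] W i)] else set0.
have dU i : (diameter (U i) <= (3 ^- n)%:E)%E.
  apply: diameter_cylinder_le => x y; rewrite /U; case: ifP => // _.
  by move=> /= -> ->.
exists U; split.
- move=> i; apply: le_trans (dU i) _; rewrite lee_fin ltW//.
  by have := N2P n (leq_maxr _ _); rewrite mul1r exprVn.
- move=> x /(C1_word n)[w wW xw]; exists (index w W) => //.
  by rewrite /U index_mem wW /= nth_index.
pose c := (3 `^ s) ^- n.
have c0 : 0 <= c by rewrite invr_ge0 exprn_ge0 ?powR_ge0.
apply: (@le_trans _ _ (\sum_(0 <= i < size W) c%:E)%E); last first.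
  rewrite sumEFin lee_fin big_const_nat subn0 iter_addr_0 -mulr_natl.
  apply: ltW; apply: le_lt_trans (N1P n (leq_maxl _ _)).
  rewrite expr_div_n mulrA ler_wpM2r// -exprD addnC.
  exact: size_words_le.
rewrite (nneseries_split 0 (size W)); last first.
  by move=> i _; exact: hausdorff_weight_ge0.
rewrite add0n [X in (_ + X)%E]eseries0 ?adde0; last first.
  move=> i Wi _; rewrite /hausdorff_weight /U ltnNge Wi /=.
  by rewrite eqxx.
apply: lee_sum => i _; rewrite /hausdorff_weight; case: ifPn => [_|].
  by rewrite lee_fin.
move=> /set0P[x Ux]; rewrite /c -(powR_exprVn _ _ (ler0n _ 3)) -poweR_EFin.
have dU0 := diameter_ge0 Ux; apply: gt0_ler_poweR => //.
  by rewrite in_itv/= leey andbT.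
by rewrite in_itv/= leey andbT lee_fin invr_ge0 exprn_ge0.
Qed.

End upper.

(** * Lower bound: distributing mass against a cover by balls *)

Section lower.

(** The pair [n], [r] stands for the ball [x n = r]; the test says that this ball lies inside the
    cylinder of [w]. *)
Definition compatible (w : seq bool) (n r : nat) : bool :=
  (size w <= n)%N && (r %% 3 ^ size w == word_val w)%N.

Lemma compatible_cons b w n r : compatible (b :: w) n r -> compatible w n r.
Proof.
move=> /andP[/= wn /eqP rw]; rewrite /compatible (ltnW wn)/=.
by rewrite -modn_exp3S rw modnMDl modn_small// word_val_lt.
Qed.

Lemma compatible_inj b c w n r :
  compatible (b :: w) n r -> compatible (c :: w) n r -> b = c.
Proof.
move=> /andP[_ /eqP/= eb] /andP[_ /eqP/=]; rewrite eb => /eqP.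
by rewrite eqn_add2r eqn_pmul2r ?expn_gt0//; case: b {eb}; case: c.
Qed.

Variables n r : nat -> nat.
Local Open Scope ereal_scope.

Definition inner_sum w : \bar R :=
  \sum_(0 <= i <oo) (if compatible w (n i) (r i) then (g ^- n i)%:E else 0).

Let term_ge0 w i : 0 <= (if compatible w (n i) (r i) then (g ^- n i)%:E else 0).
Proof. by case: ifP => // _; rewrite lee_fin invr_ge0 exprn_ge0 ?ltW. Qed.

Lemma inner_sum_ge0 w : 0 <= inner_sum w.
Proof. by apply: nneseries_ge0 => i _ _. Qed.

(** A ball lies in at most one of the two disjoint subcylinders. Equality can fail, for instance
    through balls equal to the cylinder of [w]. *)
Lemma inner_sum_cons w :
  inner_sum (false :: w) + inner_sum (true :: w) <= inner_sum w.
Proof.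
rewrite -nneseriesD//; apply: lee_nneseries => [i _ _|i _].
  by rewrite adde_ge0.
case: ifPn => [cf|_]; case: ifPn => [ct|_].
- by have := compatible_inj cf ct.
- by rewrite adde0 (compatible_cons cf).
- by rewrite add0e (compatible_cons ct).
- by rewrite adde0; exact: term_ge0.
Qed.

Lemma inner_sum_ge w i : compatible w (n i) (r i) ->
  (g ^- n i)%:E <= inner_sum w.
Proof.
move=> ci; apply: le_trans (nneseries_lim_ge i.+1 _) => [|j _ _];
  last exact: term_ge0.
rewrite big_nat_recr//= ci leeDr//.
by apply: sume_ge0 => j _; exact: term_ge0.
Qed.

(** If every allowed extension were exhausted by the cover, additivity of [mass] would make [w]
    exhausted too. *)
Lemma inner_sum_descent w : admissible k w -> inner_sum w < (mass k g w)%:E ->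
  exists b, admissible k (b :: w) /\ inner_sum (b :: w) < (mass k g (b :: w))%:E.
Proof.
move=> aw sw; have mw := mass_cons k g_gt1 g_sqr w.
have [nw|nw] := boolP (nth false w k); rewrite ?nw ?(negbTE nw) in mw.
  exists false; split=> //; move: sw; rewrite mw addr0; apply: le_lt_trans.
  by apply: le_trans (inner_sum_cons w); rewrite leeDl// inner_sum_ge0.
have [sf|sf] := ltP (inner_sum (false :: w)) (mass k g (false :: w))%:E.
  by exists false.
exists true; split; first by rewrite /= nw.
rewrite ltNge; apply/negP => st; move: sw; apply/negP; rewrite -leNgt mw EFinD.
by apply: le_trans (inner_sum_cons w); exact: leeD.
Qed.

(* Mass distribution principle without a measure: if the total mass were below
   1, one could choose the digits one by one so that the cylinders of the cover
   inside the current cylinder never exhaust its mass; the point obtained in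
   this way would not be covered. *)
Lemma cover_mass_ge1 :
  (forall x : Z3 R, E x -> exists i, x (n i) = r i) ->
  1 <= \sum_(0 <= i <oo) (g ^- n i)%:E.
Proof.
move=> cov; rewrite leNgt; apply/negP => lt1.
pose P w := admissible k w /\ inner_sum w < (mass k g w)%:E.
have P0 : P [::].
  split=> //; rewrite /mass /= invr1.
  apply: le_lt_trans lt1; apply: lee_nneseries => [i _ _|i _].
    exact: term_ge0.
  by case: ifP => // _; rewrite lee_fin invr_ge0 exprn_ge0 ?ltW.
have /choice[f fP] : forall w, exists b, P w -> P (b :: w).
  move=> w; have [[aw sw]|nP] := pselect (P w); last by exists true.
  by have [b Pb] := inner_sum_descent aw sw; exists b.
pose w m := iter m (fun u => f u :: u) [::].
pose a m := f (w m).
have aw m : prefix_word a m = w m by elim: m => //= m ->.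
have Pw m : P (w m) by elim: m => //= m /fP.
have [x ax] := expands_ex R a.
have [|i xi] := cov x.
  apply/C1E; exists a => //; apply/gap_freeP => m.
  by rewrite aw; case: (Pw m).
(* At depth [n i] the ball covering [x] is the current cylinder itself, and its weight already
   reaches the mass. *)
have [_] := Pw (n i); apply/negP; rewrite -leNgt.
have sz : size (w (n i)) = n i by rewrite -aw size_prefix_word.
have ci : compatible (w (n i)) (n i) (r i).
  rewrite /compatible sz leqnn -xi z3_mod -aw word_val_prefix.
  by have /expands_toP -> := ax; rewrite eqxx.
apply: le_trans (inner_sum_ge ci).
by rewrite lee_fin -[X in (_ <= g ^- X)%R]sz mass_le.
Qed.

End lower.

(** * Lower bound: from arbitrary covers to balls *)

Section lower_bound.
Variable s : R.
Hypotheses (s_ge0 : 0 <= s) (s_le : 3 `^ s <= g).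

(** Take the last level [m] at which [A] has a single residue: points separated at level [m.+1] give
    diameter at least [3 ^- m], and [s_le] converts this into weight. The slack [e] serves the empty
    set and single points, which have no last such level. *)
Lemma cylinder_weight (A : set (Z3 R)) (e : R) : 0 < e ->
  exists p : nat * nat, (forall x, A x -> x p.1 = p.2) /\
    ((g ^- p.1)%:E <= hausdorff_weight s A + e%:E)%E.
Proof.
move=> e0; have gV1 : `|g^-1| < 1 by rewrite ger0_norm ?invr_ge0 ?invf_lt1// ltW.
have [N /(_ N (leqnn _))] := exists_expr_small 1 gV1 e0.
rewrite mul1r exprVn => /ltW gN.
have small : ((g ^- N)%:E <= hausdorff_weight s A + e%:E)%E.
  apply: (@le_trans _ _ e%:E); rewrite ?lee_fin//.
  by rewrite leeDr// hausdorff_weight_ge0.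
have [A0|/set0P[x0 Ax0]] := eqVneq A set0.
  by exists (N, 0%N); split=> [x|]; rewrite ?A0 // -A0.
have [mP|agree] :=
    pselect (exists m, `[< ~ forall x, A x -> x m = x0 m >]); last first.
  exists (N, x0 N); split=> [x Ax|]; last exact: small.
  apply: contrapT => xN; apply: agree.
  exists N; apply/asboolP => agr; exact/xN/agr.
case: (ex_minnP mP) => m /asboolP mbad mmin.
(* At level 0 the only residue is 0, so the first disagreement occurs at a positive level. *)
case: m mbad mmin => [|m] mbad mmin.
  exfalso; apply: mbad => x _.
  by have := z3_lt x 0; have := z3_lt x0 0; case: (x 0%N); case: (x0 0%N).
exists (m, x0 m); split=> /=.
  move=> x Ax; apply: contrapT => xm.
  have /mmin : `[< ~ forall x, A x -> x m = x0 m >].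
    by apply/asboolP => agr; exact/xm/agr.
  by rewrite ltnn.
have [x Ax xm] : exists2 x, A x & x m.+1 <> x0 m.+1.
  apply: contrapT => h; apply: mbad => x Ax; apply: contrapT => xm.
  by apply: h; exists x.
have xx0 : x - x0 != 0.
  by rewrite subr_eq0; apply/eqP => e1; apply: xm; rewrite e1.
(* Nonzero distances are powers of 3, so exceeding [3 ^- m.+1] means reaching [3 ^- m]. *)
have dm : 3 ^- m <= mdist x x0.
  have := dist3_le x x0 m.+1; rewrite mdist3E; have [j ->] := norm3_exp xx0.
  have /eqP/negbTE -> := xm => /negbT; rewrite -ltNge.
  rewrite !ltf_pV2 ?posrE ?exprn_gt0// !lef_pV2 ?posrE ?exprn_gt0//.
  by rewrite ltr_eXn2l ?ltr1n// ler_eXn2l ?ltr1n.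
apply: (@le_trans _ _ (hausdorff_weight s A)); last first.
  by rewrite leeDl// lee_fin ltW.
rewrite /hausdorff_weight ifF; last by apply/negbTE/set0P; exists x.
apply: (@le_trans _ _ ((3 ^- m)%:E `^ s)%E).
  rewrite poweR_EFin lee_fin (powR_exprVn _ _ (ler0n _ 3)).
  rewrite lef_pV2 ?posrE ?exprn_gt0 ?powR_gt0//.
  by apply: lerXn2r => //; rewrite nnegrE ?powR_ge0// ltW.
have dxx0 : ((3 ^- m)%:E <= diameter A)%E.
  by apply: le_trans (le_diameter Ax Ax0); rewrite lee_fin.
apply: gt0_ler_poweR => //.
  by rewrite in_itv/= leey andbT lee_fin invr_ge0 exprn_ge0.
by rewrite in_itv/= leey andbT (diameter_ge0 Ax).
Qed.

(** A cover of weight below 1/2, with slacks summing to 1/2, would yield balls of total weight below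
    1, against [cover_mass_ge1]. *)
Lemma C1_hausdorff_measure_neq0 : hausdorff_measure s E <> 0%E.
Proof.
have h0 : 0 < 2^-1 :> R by [].
move=> /hausdorff_measure0_cover/(_ h0)[U EU sU].
have /choice[p pP] : forall i, exists p : nat * nat,
    (forall x, U i x -> x p.1 = p.2) /\
    ((g ^- p.1)%:E <= hausdorff_weight s (U i) + (2^-1 / (2 ^ i.+1)%:R)%:E)%E.
  by move=> i; apply: cylinder_weight; rewrite divr_gt0// ltr0n expn_gt0.
have : (1 <= \sum_(0 <= i <oo) (g ^- (p i).1)%:E)%E.
  apply: (@cover_mass_ge1 _ (fun i => (p i).2)) => x /EU[i _ Uix].
  by exists i; case: (pP i) => + _; exact.
apply/negP; rewrite -ltNge.
apply: (@le_lt_trans _ _ (\sum_(0 <= i <oo) hausdorff_weight s (U i) + 2^-1%:E)%E).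
  apply: le_trans (epsilon_trick _ _ _) => [|i|].
  - apply: lee_nneseries => [i _ _|i _]; last by case: (pP i).
    by rewrite lee_fin invr_ge0 exprn_ge0 ?ltW.
  - exact: hausdorff_weight_ge0.
  - exact: ltW.
have -> : 1%E = (2^-1%:E + 2^-1%:E)%E :> \bar R by rewrite -EFinD; congr EFin; lra.
by rewrite lteD2rE.
Qed.

End lower_bound.

End dimension.

(** * The dimension and the conclusion *)

Lemma hausdorff_dim_C1 (R : realType) (k : nat) :
  hausdorff_dim (C1 R (3 ^ k.+1 + 1)) = (ln (golden R) / ln 3)%:E.
Proof.
have g1 := golden_gt1 R; have g2 := golden_sqr R.
have l3 : 0 < ln 3 :> R by rewrite ln_gt0// ltr1n.
have g0 : 0 < golden R by exact: lt_trans g1.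
have lng : 0 < ln (golden R) by exact: ln_gt0.
have lnE s : ln (3 `^ s) = s * ln 3 :> R by exact: ln_powR.
apply/eqP; rewrite eq_le; apply/andP; split.
  (* At the critical exponent the measure is still nonzero, so the infimum is approached from
     above. *)
  apply/lee_addgt0Pr => e e0; apply: ereal_inf_lbound.
  exists (ln (golden R) / ln 3 + e) => //; split.
    by rewrite addr_ge0 ?divr_ge0// ltW.
  apply: (C1_hausdorff_measure0 _ g1 g2).
    by rewrite addr_ge0 ?divr_ge0// ltW.
  rewrite -ltr_ln ?posrE ?powR_gt0// lnE mulrDl divfK ?gt_eqF//.
  by rewrite ltrDl mulr_gt0.
apply: le_ereal_inf_tmp => _ [s [s0 Hs] <-]; rewrite lee_fin leNgt.
apply/negP => sd; apply: (C1_hausdorff_measure_neq0 g1 g2 s0 _ Hs).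
by rewrite -ler_ln ?posrE ?powR_gt0// lnE -ler_pdivlMr// ltW.
Qed.

Theorem theorem1p8 (R : realType) (k : nat) (hk : (1 <= k)%N) :
  let N := (3 ^ k + 1)%N in
  let d : R := ln ((1 + Num.sqrt 5) / 2) / ln 3 in
  ((vertices N #= `I_(2 ^ k))%card /\ strongly_connected (vertices N) (adj N))
  /\
  (hausdorff_dim (C1 R N) = d%:E /\
   `|d - (438 / 10 ^+ 3 + 18 / 10 ^+ 6)| <= 5 / 10 ^+ 7).
Proof.
case: k hk => [//|k _]; split.
  by split; [exact: card_vertices|exact: vertices_strongly_connected].
by split; [exact: hausdorff_dim_C1|exact: golden_dim_approx].
Qed.
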